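(* Let $X$ be a Hausdorff space and let $\tau^c$ be the family of all closed subsets of $X$. Let $Y$ be a Hausdorff space with a strictly increasing closed cover $\{B_n\}_{n\in\mathbb N}$. Then $X$ is semi-metrizable if and only if there exists a map $\phi:\tau^c\to\mathcal L(X,\mathcal F(Y))$, $F\mapsto\phi_F$ (with $\phi_x:=\phi_{\{x\}}$ for $x\in X$), such that: (i) for each $F\in\tau^c$, $F=\bigcap_{n\in\mathbb N}\phi_F^{-1}[Y\setminus B_n]$; (ii) if $F_1,F_2\in\tau^c$ and $F_1\subset F_2$, then $\phi_{F_1}(x)\subset\phi_{F_2}(x)$ for all $x\in X$; (iii) for each $x\in X$ and $F\in\tau^c$ with $x\notin F$, $\phi_x$ is bounded on $F$.
   Context: $\mathbb N$ is the set of positive integers. A sequence $\{B_n\}_{n\in\mathbb N}$ of closed subsets of a space $Y$ is a strictly increasing closed cover of $Y$ if $Y=\bigcup_{n}B_n$, $B_1\neq\emptyset$ and $B_n\subsetneq B_{n+1}$ for each $n$. $\mathcal F(Y)$ is the family of nonempty closed subsets of $Y$. For a set-valued map $\psi:X\to\mathcal F(Y)$ and $B\subset Y$, $\psi^{-1}[B]=\{x\in X:\psi(x)\cap B\neq\emptyset\}$ and $\psi^{\#}[B]=\{x\in X:\psi(x)\subset B\}$. $\psi$ is lower semi-continuous if $\psi^{-1}[V]$ is open in $X$ for each open $V\subset Y$; $\mathcal L(X,\mathcal F(Y))$ is the set of all lower semi-continuous maps $X\to\mathcal F(Y)$. $\psi$ is bounded on $A\subset X$ if $A\subset\psi^{\#}[B_n]$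 for some $n\in\mathbb N$. A space $X$ is semi-metrizable if there is a function $d:X\times X\to[0,\infty)$ (a semi-metric on $X$) such that (1) $d(x,y)=0$ if and only if $x=y$; (2) $d(x,y)=d(y,x)$ for all $x,y\in X$; (3) for each $x\in X$, $\{B(x,r):r>0\}$ is a neighborhood base of $x$, where $B(x,r)=\{y\in X:d(x,y)<r\}$ (the sets $B(x,r)$ need not be open). *)

(* Defs.v *)
From mathcomp Require Import all_boot all_order all_algebra.
From mathcomp Require Import all_classical all_reals all_analysis.
Set Implicit Arguments.
Unset Strict Implicit.
Unset Printing Implicit Defensive.
Import Order.TTheory GRing.Theory Num.Theory.
Local Open Scope classical_set_scope.
Local Open Scope ring_scope.

Definition sball (R : realType) (X : Type) (d : X -> X -> R) (x : X) (r : R) :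
  set X := [set y | d x y < r].

(* The balls need not be open, so being a neighborhood base at x requires
   every ball to be a (not necessarily open) neighborhood of x. *)
Definition semi_metric (R : realType) (X : topologicalType)
    (d : X -> X -> R) : Prop :=
  [/\ forall x y, 0 <= d x y,
      forall x y, d x y = 0 <-> x = y,
      forall x y, d x y = d y x
    & forall x, (forall r, 0 < r -> nbhs x (sball d x r)) /\
        (forall U, nbhs x U -> exists2 r, 0 < r & sball d x r `<=` U)].

Definition semi_metrizable (R : realType) (X : topologicalType) : Prop :=
  exists d : X -> X -> R, semi_metric d.

(* Covers are indexed from 0: B n stands for the classical B_{n+1}. *)
Definition strictly_increasing_closed_cover (Y : topologicalType)
    (B : nat -> set Y) : Prop :=
  [/\ forall n, closed (B n),
      \bigcup_n B n = [set: Y],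
      B 0%N !=set0
    & forall n, B n `<` B n.+1].

Definition lower_preimage (X Y : Type) (psi : X -> set Y) (B : set Y) : set X :=
  [set x | psi x `&` B !=set0].

Definition upper_preimage (X Y : Type) (psi : X -> set Y) (B : set Y) : set X :=
  [set x | psi x `<=` B].

Definition nonempty_closed_sets (Y : topologicalType) : set (set Y) :=
  [set C | closed C /\ C !=set0].

Definition lsc_maps (X Y : topologicalType) : set (X -> set Y) :=
  [set psi | (forall x, nonempty_closed_sets (psi x)) /\
             (forall V, open V -> open (lower_preimage psi V))].

Definition bounded_on_cover (X Y : Type) (B : nat -> set Y)
    (psi : X -> set Y) (A : set X) : Prop :=
  exists n, A `<=` upper_preimage psi (B n).

(* Main.v *)
Require Import Defs.
From mathcomp Require Import all_boot all_order all_algebra.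
From mathcomp Require Import all_classical all_reals all_analysis.
Import Order.TTheory GRing.Theory Num.Theory.
Local Open Scope classical_set_scope.

(** Both sides of the equivalence say that closed sets can be shrunk onto, in
    a monotone way, by countably many open sets: there are open [G n F],
    decreasing in [n] and increasing in [F], whose intersection over [n] is
    [F], and such that [G n [set x]] misses [F] for large [n] if [x] is not
    in [F] (predicate [monotone_expansion]).

    Such a [G] and a map [phi] determine each other through level sets.  From
    [phi], take for [G n F] the set of points where [phi F] leaves [B n]; it
    is open since [B n] is closed and [phi F] is lower semi-continuous
    ([monotone_expansion_of_lsc]).  From [G], let [phi F x] be the largest
    set contained in [B n] whenever [x] lies outside [G n F]
    ([level_map_lsc]).

    From a semi-metric, [G n F] is the interior of the union of the balls of
    radius [1 / (n + 1)] centred in [F] ([monotone_expansion_of_semi_metric]).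
    Conversely, given [G], call [x] and [y] close at rank [n] if one of them
    lies in [G n] of the other.  The points close to [x] at rank [n] form a
    neighborhood base at [x]: those in [G n [set x]] tend to [x] by the
    separation property, and those [y] with [x] in [G n [set y]] tend to [x]
    because, if they stayed in a closed set [F] missing [x], then [x] would be
    in every [G n F], that is in [F].  A decreasing sequence of reflexive and
    symmetric relations with this property on a Hausdorff space comes from a
    semi-metric ([semi_metrizable_of_closeness]). *)

Local Open Scope ring_scope.

(** The first four clauses are those of a semi-stratification; on a space with
    closed points, the last one makes the sets [G n [set x]] a countable
    neighborhood base at [x]. *)
Definition monotone_expansion {X : topologicalType}
    (G : nat -> set X -> set X) : Prop :=
  [/\ forall n F, closed F -> open (G n F),
      forall m n F, closed F -> (m <= n)%N -> G n F `<=` G m F,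
      forall F, closed F -> F = \bigcap_n G n F,
      forall n F1 F2, closed F1 -> closed F2 -> F1 `<=` F2 ->
        G n F1 `<=` G n F2
    & forall (x : X) F, closed F -> ~ F x ->
        exists n, F `&` G n [set x] = set0].

(** * Semi-metrics from decreasing closeness relations *)

Section RankMetric.
Variables (R : realType) (X : Type) (E : nat -> X -> X -> Prop).
Hypothesis E_anti : forall m n x y, (m <= n)%N -> E n x y -> E m x y.

Definition failure_radii (x y : X) : set R :=
  [set r | r = 0 \/ exists2 n, ~ E n x y & r = n.+1%:R^-1].

(** As [E] decreases, this is [1 / (n + 1)] for the first rank [n] at which
    [x] and [y] are no longer close, and [0] if there is no such rank. *)
Definition rank_metric (x y : X) : R := sup (failure_radii x y).

Lemma has_sup_failure_radii x y : has_sup (failure_radii x y).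
Proof.
split; first by exists 0; left.
exists 1 => _ [->|[n _ ->]]; first exact: ler01.
by rewrite invf_le1 ?ltr0n// ler1n.
Qed.

Lemma rank_metric_ge0 x y : 0 <= rank_metric x y.
Proof. by apply: ub_le_sup; [case: (has_sup_failure_radii x y)|left]. Qed.

Lemma rank_metric_ltP n x y : rank_metric x y < n.+1%:R^-1 <-> E n x y.
Proof.
split=> [lt_d|Exy].
  apply: contrapT => nE; move: lt_d; apply/negP; rewrite -leNgt.
  by apply: ub_le_sup; [case: (has_sup_failure_radii x y)|right; exists n].
have : rank_metric x y <= n.+2%:R^-1.
  apply: ge_sup; first by case: (has_sup_failure_radii x y).
  move=> _ [->|[m nE ->]]; first by rewrite invr_ge0 ler0n.
  rewrite lef_pV2 ?posrE ?ltr0n// ler_nat ltnS ltnNge.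
  by apply/negP => le_mn; apply: nE; exact: E_anti Exy.
by move/le_lt_trans; apply; rewrite ltf_pV2 ?posrE ?ltr0n// ltr_nat.
Qed.

End RankMetric.

Lemma small_harmonic (R : realType) (r : R) :
  0 < r -> exists n : nat, n.+1%:R^-1 < r.
Proof.
move=> r0; exists (Num.truncn r^-1); rewrite invf_plt ?posrE ?ltr0n//.
exact: truncnS_gt.
Qed.

(** The ball of radius [1 / (n + 1)] of the rank metric at [x] is exactly the
    set of points close to [x] at rank [n].  Distinct points are at positive
    distance because the complement of one of them is a neighborhood of the
    other. *)
Lemma semi_metrizable_of_closeness (R : realType) (X : topologicalType)
    (E : nat -> X -> X -> Prop) :
  hausdorff_space X ->
  (forall m n x y, (m <= n)%N -> E n x y -> E m x y) ->
  (forall n x, E n x x) -> (forall n x y, E n x y -> E n y x) ->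
  (forall n x, nbhs x [set y | E n x y]) ->
  (forall x U, nbhs x U -> exists n, [set y | E n x y] `<=` U) ->
  semi_metrizable R X.
Proof.
move=> hX anti refl sym nE base; exists (rank_metric R X E).
have sballE x n : sball (rank_metric R X E) x n.+1%:R^-1 = [set y | E n x y].
  by apply/seteqP; split=> y; rewrite /sball/= rank_metric_ltP.
split.
- exact: rank_metric_ge0.
- move=> x y; split=> [d0|<-].
    have Exy n : E n x y by apply/(rank_metric_ltP R) => //; rewrite d0 invr_gt0.
    apply: contrapT => neq_xy.
    have [n /(_ y (Exy n))]: exists n, [set z | E n x z] `<=` ~` [set y].
      apply/base/open_nbhs_nbhs; split=> //=; apply/closed_openC.
      exact/accessible_closed_set1/hausdorff_accessible.
    by apply.
  apply/eqP; rewrite eq_le rank_metric_ge0 andbT leNgt; apply/negP.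
  move=> /small_harmonic[n] /lt_trans lt_n.
  have : rank_metric R X E x x < n.+1%:R^-1 by apply/rank_metric_ltP.
  by move=> /lt_n; rewrite ltxx.
- move=> x y; congr sup.
  by apply/seteqP; split=> r [->|[n nExy ->]]; (try by left); right;
    exists n => // /sym.
- move=> x; split=> [r /small_harmonic[n lt_n]|U /base[n EU]].
    apply: filterS (nE n x); rewrite -sballE => y /= dxy.
    exact: lt_trans dxy lt_n.
  by exists n.+1%:R^-1; rewrite ?invr_gt0 ?ltr0n// sballE.
Qed.

(** * Monotone expansions and semi-metrics *)

(** A point [x] of every [G n F] has points of [F] whose distance to it is
    arbitrarily small; by symmetry they enter every ball centred at [x], so
    that [x] is in the closure of [F]. *)
Lemma monotone_expansion_of_semi_metric {R : realType} {X : topologicalType} :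
  semi_metrizable R X ->
  exists G : nat -> set X -> set X, monotone_expansion G.
Proof.
move=> [d [d_ge0 d_eq0 d_sym d_base]].
pose U n F := \bigcup_(x in F) sball d x n.+1%:R^-1.
have Uanti m n F : (m <= n)%N -> U n F `<=` U m F.
  move=> le_mn y [x Fx dxy]; exists x => //; apply: lt_le_trans dxy _.
  by rewrite lef_pV2 ?posrE ?ltr0n// ler_nat.
exists (fun n F => (U n F)°); split.
- by move=> n F _; exact: open_interior.
- by move=> m n F _ le_mn; exact/interiorS/Uanti.
- move=> F cF; apply/seteqP; split=> [x Fx n _|x FGx].
    have [nball _] := d_base x; have := nball n.+1%:R^-1.
    rewrite invr_gt0 ltr0n => /(_ isT); apply: filterS => y xy.
    by exists x.
  apply: cF => V /(d_base x).2[r /small_harmonic[n lt_n] dV].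
  have [y Fy dyx] := interior_subset (FGx n I).
  by exists y; split=> //; apply: dV; rewrite /sball/= d_sym; exact: lt_trans lt_n.
- move=> n F1 F2 _ _ F12; apply: interiorS => y [x F1x dxy].
  by exists x => //; exact: F12.
- move=> x F cF nFx.
  have [r /small_harmonic[n lt_n] dF] : exists2 r, 0 < r & sball d x r `<=` ~` F.
    by apply: (d_base x).2; apply: open_nbhs_nbhs; split=> //; exact: closed_openC.
  exists n; apply/seteqP; split=> // y [Fy /interior_subset[_ -> dxy]].
  by apply: (dF y) => //; exact: lt_trans lt_n.
Qed.

(** Closeness of [x] and [y] at rank [n] allows both [y] in [G n [set x]] and
    [x] in [G n [set y]].  For a neighborhood of [x] with closed complement
    [F], the first is ruled out on [F] from a rank [m] on by separation, the
    second from a rank [k] on because [x] leaves [G k F], which contains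
    [G k [set y]] for every [y] in [F]. *)
Lemma semi_metrizable_of_monotone_expansion {R : realType}
    {X : topologicalType} (G : nat -> set X -> set X) :
  hausdorff_space X -> monotone_expansion G -> semi_metrizable R X.
Proof.
move=> hX [Gopen Ganti Gcap Gmono Gsep].
have c1 (x : X) : closed [set x].
  exact/accessible_closed_set1/hausdorff_accessible.
have G1 n x : G n [set x] x.
  have : [set x] x by [].
  by rewrite {1}(Gcap _ (c1 x)); apply.
pose E n x y := G n [set x] y \/ G n [set y] x.
apply: (semi_metrizable_of_closeness R X E) => //.
- by move=> m n x y le_mn [|] /(Ganti _ _ _ (c1 _) le_mn); [left|right].
- by left.
- by move=> n x y [|]; [right|left].
- move=> n x; apply: (@filterS _ _ _ (G n [set x])); first by left.
  by apply: open_nbhs_nbhs; split; [exact: Gopen|].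
- move=> x V; rewrite nbhsE => -[W [oW Wx] WV].
  have cW : closed (~` W) by exact: open_closedC.
  have nWx : ~ (~` W) x by apply.
  have [m Gm] := Gsep x _ cW nWx.
  have [k nGk] : exists k, ~ G k (~` W) x.
    by apply/existsNP => Gx; apply: nWx; rewrite (Gcap _ cW) => k _.
  exists (maxn m k) => y Exy; apply: WV; apply: contrapT => nWy.
  case: Exy => [/(Ganti _ _ _ (c1 _) (leq_maxl m k)) Gy|].
    by have : (~` W `&` G m [set x]) y by []; rewrite Gm.
  move=> /(Ganti _ _ _ (c1 _) (leq_maxr m k)) Gx; apply: nGk.
  by apply: (Gmono k _ _ (c1 y) cW _ x Gx) => _ ->.
Qed.

(** * Monotone expansions and lower semi-continuous maps *)

Section Cover.
Context {Y : topologicalType} {B : nat -> set Y}.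
Hypothesis hB : strictly_increasing_closed_cover B.

Lemma cover_le m n : (m <= n)%N -> B m `<=` B n.
Proof.
case: hB => _ _ _ Blt.
elim: n => [|n IHn]; first by rewrite leqn0 => /eqP ->.
rewrite leq_eqVlt => /predU1P[-> //|]; rewrite ltnS => /IHn Bmn.
by apply: (subset_trans Bmn); case: (Blt n).
Qed.

(** The inclusions being strict, no stage of the cover is everything: this is
    what allows a closed set to be read off the points where a map leaves
    every [B n]. *)
Lemma cover_notin n : ([set: Y] `\` B n) !=set0.
Proof.
case: hB => _ _ _ /(_ n)[_ /existsNP[y /not_implyP[_ nBy]]].
by exists y.
Qed.

Lemma cover_in y : exists n, B n y.
Proof.
case: hB => _ Bcup _ _.
have [n _ Bny] : (\bigcup_n B n) y by rewrite Bcup.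
by exists n.
Qed.

Lemma monotone_expansion_of_lsc {X : topologicalType}
    (phi : set X -> X -> set Y) :
  (forall F, closed F -> lsc_maps (phi F)) ->
  (forall F, closed F ->
    F = \bigcap_n lower_preimage (phi F) ([set: Y] `\` B n)) ->
  (forall F1 F2, closed F1 -> closed F2 -> F1 `<=` F2 ->
    forall x, phi F1 x `<=` phi F2 x) ->
  (forall (x : X) F, closed F -> ~ F x ->
    bounded_on_cover B (phi [set x]) F) ->
  monotone_expansion (fun n F => lower_preimage (phi F) ([set: Y] `\` B n)).
Proof.
move=> lsc cap mono bnd; split.
- move=> n F cF; apply: (lsc F cF).2.
  by rewrite setTD; apply: closed_openC; case: hB.
- move=> m n F cF le_mn x [y [Fy [_ nBy]]]; exists y; split=> //; split=> //.
  by move=> /(cover_le m n le_mn).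
- exact: cap.
- move=> n F1 F2 c1 c2 F12 x [y [Fy nBy]]; exists y; split=> //.
  exact: (mono F1 F2).
- move=> x F cF nFx; have [n Fn] := bnd x F cF nFx.
  exists n; apply/seteqP; split=> // z [Fz [y [phiy [_ nBy]]]].
  exact/nBy/(Fn z Fz).
Qed.

(** Defined as an intersection of stages of the cover so that its values are
    closed and contain [B 0] without further argument.  For a decreasing [G] it
    is [B n] for the first [n] with [x] outside [G n], and the whole of [Y] if
    [x] lies in every [G n]. *)
Definition level_map {X : Type} (G : nat -> set X) (x : X) : set Y :=
  [set y | forall n, ~ G n x -> B n y].

(** The set of [x] with [y] in [level_map G x] is the intersection of the
    [G n] over the ranks [n] with [y] outside [B n].  These ranks form an
    initial segment of [nat], which is finite because the [B n] cover, so this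
    intersection is the whole space or a single [G n]. *)
Lemma open_level_map_mem {X : topologicalType} (G : nat -> set X) y :
  (forall n, open (G n)) ->
  (forall m n, (m <= n)%N -> G n `<=` G m) ->
  open [set x | level_map G x y].
Proof.
move=> Gopen Ganti.
have exB : exists n, `[< B n y >] by have [n ?] := cover_in y; exists n; exact/asboolP.
have [[|m] /asboolP Bmy min_m] := find_ex_minn exB.
  rewrite (_ : [set _ | _] = setT); first exact: openT.
  by apply/seteqP; split=> // x _ n _; exact: (cover_le 0).
rewrite (_ : [set _ | _] = G m) //.
apply/seteqP; split=> [x xy|x Gx n nGx].
  apply: contrapT => /xy Bm; have := min_m m.
  by rewrite ltnn => /(_ (introT (asboolP _) Bm)).
apply: (cover_le m.+1) => //; rewrite ltnNge; apply/negP => le_nm.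
by apply: nGx; exact: Ganti Gx.
Qed.

Lemma level_map_lsc {X : topologicalType} (G : nat -> set X) :
  (forall n, open (G n)) ->
  (forall m n, (m <= n)%N -> G n `<=` G m) ->
  lsc_maps (level_map G).
Proof.
move=> Gopen Ganti; case: (hB) => Bclosed _ [y0 By0] _; split=> [x|V _].
  split; last by exists y0 => n _; exact: (cover_le 0) By0.
  rewrite (_ : level_map G x = \bigcap_(n in [set n | ~ G n x]) B n) //.
  by apply: closed_bigI => n _; exact: Bclosed.
rewrite (_ : lower_preimage _ _ = \bigcup_(y in V) [set x | level_map G x y]).
  by apply: bigcup_open => y _; exact: open_level_map_mem.
by apply/seteqP; split=> x [y]; [case=> xy Vy|move=> Vy xy]; exists y.
Qed.

Lemma lower_preimage_level_map {X : Type} (G : nat -> set X) :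
  \bigcap_n lower_preimage (level_map G) ([set: Y] `\` B n) = \bigcap_n G n.
Proof.
apply/seteqP; split=> x Gx n _.
  have [y [xy [_ nBy]]] := Gx n I.
  by apply: contrapT => /xy.
have [y nBy] := cover_notin n.
by exists y; split=> // k /(_ (Gx k I)).
Qed.

End Cover.

Theorem theorem4p1 (R : realType) (X Y : topologicalType) (B : nat -> set Y)
    (hX : hausdorff_space X) (hY : hausdorff_space Y)
    (hB : strictly_increasing_closed_cover B) :
  semi_metrizable R X <->
  exists phi : set X -> X -> set Y,
    [/\ forall F, closed F -> lsc_maps (phi F),
        forall F, closed F ->
          F = \bigcap_n lower_preimage (phi F) ([set: Y] `\` B n),
        forall F1 F2, closed F1 -> closed F2 -> F1 `<=` F2 ->
          forall x, phi F1 x `<=` phi F2 x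
      & forall (x : X) F, closed F -> ~ F x ->
          bounded_on_cover B (phi [set x]) F].
Proof.
split=> [/monotone_expansion_of_semi_metric[G]|[phi [lsc cap mono bnd]]].
  case=> Gopen Ganti Gcap Gmono Gsep.
  exists (fun F => level_map (B := B) (fun n => G n F)); split.
  - move=> F cF; apply: (level_map_lsc hB) => [n|m n]; first exact: Gopen.
    exact: Ganti.
  - by move=> F cF; rewrite (lower_preimage_level_map hB) -Gcap.
  - move=> F1 F2 c1 c2 F12 x y xy n nGx; apply: xy => /Gmono-/(_ F2 c1 c2 F12).
    exact: nGx.
  - move=> x F cF nFx; have [n FG] := Gsep x F cF nFx.
    exists n => z Fz y; apply => Gz.
    by have : (F `&` G n [set x]) z by []; rewrite FG.
apply: semi_metrizable_of_monotone_expansion hX _.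
exact: (monotone_expansion_of_lsc hB phi).
Qed.
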